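(* Let $({}_{f_2}M_1\times{}_{f_1}M_2,F)$ be a doubly warped product Finsler manifold. If $F$ is C-reducible, then $({}_{f_2}M_1\times{}_{f_1}M_2,F)$ is a Riemannian manifold.
   Context: A Finsler metric on a manifold $M$ is a function $F:TM\to[0,\infty)$ that is $C^\infty$ on the slit tangent bundle $TM^\circ$ (tangent bundle minus the zero section), positively $1$-homogeneous on fibres, and whose fibre Hessian of $\frac12F^2$ is positive definite. Let $(M_1,F_1)$, $(M_2,F_2)$ be Finsler manifolds of dimensions $n_1,n_2$, and let $f_1:M_1\to\mathbb{R}^+$, $f_2:M_2\to\mathbb{R}^+$ be smooth (the warping functions). The doubly warped product Finsler manifold $({}_{f_2}M_1\times{}_{f_1}M_2,F)$ is $M=M_1\times M_2$ with $$F(v_1,v_2)=\sqrt{f_2^2(\pi_2(v_2))F_1^2(v_1)+f_1^2(\pi_1(v_1))F_2^2(v_2)},\qquad (v_1,v_2)\in TM^\circ:=TM_1^\circ\times TM_2^\circ,$$ where $\pi_1,\pi_2$ are the base-point projections; all objects are considered on $TM^\circ$. Put $n=n_1+n_2$ and let $\mathbf{y}^a$ be fibre coordinates on $TM$ induced by local coordinates on $M$. Set $\mathbf{g}_{ab}=\frac12\frac{\partial^2F^2}{\partial\mathbf{y}^a\partial\mathbf{y}^b}$, with inverse $\mathbf{g}^{ab}$, Cartan tensor $\mathbf{C}_{abc}=\frac12\frac{\partial\mathbf{g}_{ab}}{\partial\mathbf{y}^c}$, mean Cartan torsion $\mathbf{I}_a=\mathbf{g}^{bc}\mathbf{C}_{abc}$,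 $\mathbf{y}_a=\mathbf{g}_{ab}\mathbf{y}^b$, angular metric $\mathbf{h}_{ab}=\mathbf{g}_{ab}-\frac1{F^2}\mathbf{y}_a\mathbf{y}_b$, and Matsumoto torsion $$\mathbf{M}_{abc}=\mathbf{C}_{abc}-\frac1{n+1}\{\mathbf{I}_a\mathbf{h}_{bc}+\mathbf{I}_b\mathbf{h}_{ac}+\mathbf{I}_c\mathbf{h}_{ab}\}.$$ $F$ is C-reducible if $\mathbf{M}_{abc}=0$. A Finsler metric is Riemannian if and only if its Cartan tensor vanishes. *)

(* Defs.v *)
(* MathComp / MathComp-Analysis. *)
From HB Require Import structures.
From mathcomp Require Import all_boot all_order all_algebra.
From mathcomp Require Import all_classical all_reals all_analysis.

Set Implicit Arguments.
Unset Strict Implicit.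
Unset Printing Implicit Defensive.

Import Order.TTheory GRing.Theory Num.Theory.
Import numFieldNormedType.Exports.

Local Open Scope classical_set_scope.
Local Open Scope ring_scope.

(* Only meant for open U.  In finite dimension, differentiability together with
   C^k dependence of all directional derivatives is the usual C^(k+1). *)
Fixpoint cont_diff (R : realType) (V W : normedModType R) (k : nat)
    (U : set V) (f : V -> W) : Prop :=
  if k is k'.+1 then
    (forall x, U x -> differentiable f x) /\
    (forall v, cont_diff k' U (fun x => 'd f x v))
  else forall x, U x -> {for x, continuous f}.

Definition smooth_on (R : realType) (V W : normedModType R)
    (U : set V) (f : V -> W) : Prop := forall k, cont_diff k U f.

(* A smooth manifold of dimension n is presented by one smooth atlas.
   chart i and inv_chart i are total functions, meaningful only on dom i and
   on its image in R^n. *)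
Record manifold (R : realType) (n : nat) := Manifold {
  carrier :> topologicalType ;
  carrier_hausdorff : hausdorff_space carrier ;
  carrier_second_countable : @second_countable carrier ;
  chart_index : Type ;
  dom : chart_index -> set carrier ;
  chart : chart_index -> carrier -> 'rV[R]_n ;
  inv_chart : chart_index -> 'rV[R]_n -> carrier ;
  dom_cover : forall p, exists i, dom i p ;
  dom_open : forall i, open (dom i) ;
  chart_open : forall i, open (chart i @` dom i) ;
  chartK : forall i, {in dom i, cancel (chart i) (inv_chart i)} ;
  chart_continuous : forall i, {within dom i, continuous (chart i)} ;
  inv_chart_continuous :
    forall i, {within chart i @` dom i, continuous (inv_chart i)} ;
  chart_smooth : forall i j,
    smooth_on (chart i @` (dom i `&` dom j)) (chart j \o inv_chart i)
}.

Definition transition (R : realType) (n : nat) (M : manifold R n)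
    (i j : chart_index M) : 'rV[R]_n -> 'rV[R]_n := chart j \o inv_chart i.

(* A tangent vector is a base point with its components in every chart, which
   transform by the differentials of the transition maps; components in charts
   not containing the base point are set to 0. *)
Record tangent (R : realType) (n : nat) (M : manifold R n) := Tangent {
  base : M ;
  components : chart_index M -> 'rV[R]_n ;
  components_transition : forall i j, dom i base -> dom j base ->
    components j = 'd (transition i j) (chart i base) (components i) ;
  components_out : forall i, ~ dom i base -> components i = 0
}.

Lemma diff_comp_near (R : realType) (U V W : normedModType R)
    (f : U -> V) (g : V -> W) (h : U -> W) (x y : U) :
  differentiable f x -> differentiable g (f x) -> differentiable h x ->
  (\forall z \near x, h z = g (f z)) -> 'd h x y = 'd g (f x) ('d f x y).
Proof.
move=> df dg dh hgf.
have dgf : differentiable (g \o f) x by exact: differentiable_comp.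
rewrite -deriveE // (near_eq_derive _ hgf) -[LHS]/('D_y (g \o f) x) deriveE //.
by rewrite diff_comp.
Qed.

Section TangentFacts.
Variables (R : realType) (n : nat) (M : manifold R n).
Implicit Types (i j k : chart_index M) (p : M) (y : 'rV[R]_n).

Lemma eq_tangent (v w : tangent M) :
  base v = base w -> components v = components w -> v = w.
Proof.
case: v w => [p c Hc Oc] [q d Hd Od] /= pq cd; move: Hc Oc Hd Od.
by rewrite pq cd => *; congr Tangent; exact: Prop_irrelevance.
Qed.

Lemma transition_differentiable i j p : dom i p -> dom j p ->
  differentiable (transition i j) (chart i p).
Proof. by move=> pi pj; have [+ _] := chart_smooth i j 1; apply; exists p. Qed.

Lemma near_dom i j p : dom i p -> dom j p ->
  \forall x \near chart i p, dom j (inv_chart i x).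
Proof.
move=> pi pj.
have cip : (chart i @` dom i) (chart i p) by exists p.
have := @inv_chart_continuous _ _ M i.
rewrite continuous_open_subspace; last exact: chart_open.
move=> /(_ (chart i p)); rewrite inE => /(_ cip) ci.
have invp : inv_chart i (chart i p) = p by rewrite chartK // inE.
apply: (ci (dom j)); rewrite invp.
by apply: open_nbhs_nbhs; split => //; exact: dom_open.
Qed.

Lemma diff_transition_comp i j k p y :
  dom i p -> dom j p -> dom k p ->
  'd (transition i k) (chart i p) y =
  'd (transition j k) (chart j p) ('d (transition i j) (chart i p) y).
Proof.
move=> pi pj pk.
have tp : chart j p = transition i j (chart i p).
  by rewrite /transition /= chartK // inE.
rewrite tp; apply: diff_comp_near.
- exact: transition_differentiable.
- by rewrite -tp; exact: transition_differentiable.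
- exact: transition_differentiable.
- apply: filterS (near_dom pi pj) => x jx.
  by rewrite /transition /= chartK // inE.
Qed.

Lemma diff_transition_id i p y : dom i p ->
  'd (transition i i) (chart i p) y = y.
Proof.
move=> pi; rewrite -deriveE; last exact: transition_differentiable.
have -> : 'D_y (transition i i) (chart i p) = 'D_y id (chart i p).
  apply: near_eq_derive.
  have : nbhs (chart i p) (chart i @` dom i).
    by apply: open_nbhs_nbhs; split; [exact: chart_open|exists p].
  by apply: filterS => _ [q qi <-]; rewrite /transition /= chartK // inE.
by rewrite derive_id.
Qed.

Definition components_at i p y j : 'rV[R]_n :=
  if `[< dom i p /\ dom j p >] then 'd (transition i j) (chart i p) y else 0.

Fact components_at_transition i p y j k : dom j p -> dom k p ->
  components_at i p y k = 'd (transition j k) (chart j p) (components_at i p y j).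
Proof.
rewrite /components_at => pj pk; case: (pselect (dom i p)) => pi.
  by rewrite !asboolT //; exact: diff_transition_comp.
by rewrite !asboolF ?linear0 // => -[].
Qed.

Fact components_at_out i p y j : ~ dom j p -> components_at i p y j = 0.
Proof. by move=> pj; rewrite /components_at asboolF // => -[]. Qed.

(* The vector at p with components y in chart i (the zero vector if p is not in
   dom i). *)
Definition tangent_at i p y : tangent M :=
  Tangent (@components_at_transition i p y) (@components_at_out i p y).

Fact scale_transition (a : R) (v : tangent M) i j :
  dom i (base v) -> dom j (base v) ->
  a *: components v j =
  'd (transition i j) (chart i (base v)) (a *: components v i).
Proof. by move=> vi vj; rewrite linearZ /= -components_transition. Qed.

Fact scale_out (a : R) (v : tangent M) i :
  ~ dom i (base v) -> a *: components v i = 0.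
Proof. by move=> vi; rewrite components_out // scaler0. Qed.

Definition tangent_scale (a : R) (v : tangent M) : tangent M :=
  @Tangent R n M (base v) (fun i => a *: components v i)
    (@scale_transition a v) (@scale_out a v).

Lemma components_tangent_at i p y : dom i p ->
  components (tangent_at i p y) i = y.
Proof.
by move=> pi; rewrite /= /components_at asboolT //; exact: diff_transition_id.
Qed.

Lemma tangent_at_components i (v : tangent M) :
  dom i (base v) -> tangent_at i (base v) (components v i) = v.
Proof.
move=> vi; apply: eq_tangent => //=; apply/funext => j; rewrite /components_at.
case: (pselect (dom j (base v))) => vj.
  by rewrite asboolT //; exact/esym/components_transition.
by rewrite asboolF ?components_out // => -[].
Qed.

End TangentFacts.

(* Tensors at y attached to the restriction Phi of a metric to one fibre,
   read in fibre coordinates R^n; indices are those of the tensors. *)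
Section FibreTensors.
Variables (R : realType) (n : nat).
Implicit Types (Phi f : 'rV[R]_n -> R) (y : 'rV[R]_n) (a b c : 'I_n).

Definition pderiv a f y : R := 'D_(delta_mx 0 a) (f : 'rV[R]_n -> R^o) y.

Definition fundamental Phi y : 'M[R]_n :=
  \matrix_(a, b) (2^-1 * pderiv a (pderiv b (fun z => Phi z ^+ 2)) y).

Definition cartan Phi y a b c : R :=
  2^-1 * pderiv c (fun z => fundamental Phi z a b) y.

Definition mean_cartan Phi y a : R :=
  \sum_b \sum_c invmx (fundamental Phi y) b c * cartan Phi y a b c.

Definition lowered Phi y a : R := \sum_b fundamental Phi y a b * y 0 b.

Definition angular Phi y a b : R :=
  fundamental Phi y a b - (Phi y ^+ 2)^-1 * (lowered Phi y a * lowered Phi y b).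

Definition matsumoto Phi y a b c : R :=
  cartan Phi y a b c - (n%:R + 1)^-1 *
    (mean_cartan Phi y a * angular Phi y b c +
     mean_cartan Phi y b * angular Phi y a c +
     mean_cartan Phi y c * angular Phi y a b).

Definition posdef (g : 'M[R]_n) : Prop :=
  forall z : 'rV[R]_n, z != 0 -> 0 < (z *m g *m z^T) 0 0.

End FibreTensors.

Record finsler (R : realType) (n : nat) (M : manifold R n) := Finsler {
  metric :> tangent M -> R ;
  metric_ge0 : forall v, 0 <= metric v ;
  metric_smooth : forall i : chart_index M,
    smooth_on [set z : 'rV[R]_n * 'rV[R]_n |
                (chart i @` dom i) z.1 /\ z.2 != 0]
      ((fun z => metric (tangent_at i (inv_chart i z.1) z.2))
        : 'rV[R]_n * 'rV[R]_n -> R^o) ;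
  metric_homogeneous : forall (a : R) v, 0 < a ->
    metric (tangent_scale a v) = a * metric v ;
  metric_convex : forall (i : chart_index M) p y, dom i p -> y != 0 ->
    posdef (fundamental (fun z => metric (tangent_at i p z)) y)
}.

Record warping (R : realType) (n : nat) (M : manifold R n) := Warping {
  warp :> M -> R ;
  warp_gt0 : forall p, 0 < warp p ;
  warp_smooth : forall i : chart_index M,
    smooth_on (chart i @` dom i) (warp \o inv_chart i : 'rV[R]_n -> R^o)
}.

Section DoublyWarped.
Variables (R : realType) (n1 n2 : nat).
Variables (M1 : manifold R n1) (M2 : manifold R n2).

Definition doubly_warped (F1 : finsler M1) (F2 : finsler M2)
    (f1 : warping M1) (f2 : warping M2) (v : tangent M1 * tangent M2) : R :=
  Num.sqrt (f2 (base v.2) ^+ 2 * F1 v.1 ^+ 2 + f1 (base v.1) ^+ 2 * F2 v.2 ^+ 2).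

(* T(M1 x M2) is identified with TM1 x TM2.  In the product of the charts i1
   and i2, fibre coordinates are the row vectors y = (y1, y2) of size n1 + n2. *)
Definition fibre_metric (F : tangent M1 * tangent M2 -> R)
    (i1 : chart_index M1) (p1 : M1) (i2 : chart_index M2) (p2 : M2)
    (y : 'rV[R]_(n1 + n2)) : R :=
  F (tangent_at i1 p1 (lsubmx y), tangent_at i2 p2 (rsubmx y)).

(* TM1° x TM2° at (p1, p2) : both components are nonzero. *)
Definition slit_fibre : set 'rV[R]_(n1 + n2) :=
  [set y | lsubmx y != 0 /\ rsubmx y != 0].

Definition C_reducible (F : tangent M1 * tangent M2 -> R) : Prop :=
  forall i1 p1 i2 p2 y, dom i1 p1 -> dom i2 p2 -> slit_fibre y ->
  forall a b c, matsumoto (fibre_metric F i1 p1 i2 p2) y a b c = 0.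

(* F^2 is given by an inner product.  As F is only considered on TM1° x TM2°,
   whose fibres are disconnected when n1 = 1 or n2 = 1, the inner product is
   attached to a connected part A of the slit fibre; if n1, n2 >= 2, A may be
   the whole slit fibre.  On a one-dimensional factor, F1 may well have
   F1(-v) != F1(v) although the Cartan tensor vanishes. *)
Definition riemannian (F : tangent M1 * tangent M2 -> R) : Prop :=
  forall i1 p1 i2 p2 (A : set 'rV[R]_(n1 + n2)), dom i1 p1 -> dom i2 p2 ->
  connected A -> A `<=` slit_fibre ->
  exists q : 'M[R]_(n1 + n2), [/\ q^T = q, posdef q &
    forall y, A y -> fibre_metric F i1 p1 i2 p2 y ^+ 2 = (y *m q *m y^T) 0 0].

End DoublyWarped.

(* Main.v *)
(* On a fibre, F^2 = Phi1(y1)^2 + Phi2(y2)^2, so the fundamental tensor is block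
   diagonal and every mixed component of the Cartan tensor vanishes.  Hence
   u = (y1, 0), like y itself, satisfies u^a C_abc = 0.  Contracting M_abc = 0
   with u^a u^b leaves I_c h(u, u) = 0, and h(u, u) = X Y / (X + Y) > 0, where X
   and Y are the squared lengths of the two components of y.  So I = 0, hence
   C = 0, and the fundamental tensor g is locally constant on the slit fibre;
   moreover F^2 = g(y, y) by Euler's theorem. *)
Require Import Defs.
From mathcomp Require Import all_boot all_order all_algebra.
From mathcomp Require Import all_classical all_reals all_analysis.
From mathcomp Require Import ring.

Set Implicit Arguments.
Unset Strict Implicit.
Unset Printing Implicit Defensive.

Import Order.TTheory GRing.Theory Num.Theory.
Import numFieldNormedType.Exports.

Local Open Scope classical_set_scope.
Local Open Scope ring_scope.

(** * Locality of differentiability and of the classes C^k *)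

Lemma open_near (R : realType) (V : normedModType R) (U : set V) x
    (P : V -> Prop) :
  open U -> U x -> (forall y, U y -> P y) -> \forall y \near x, P y.
Proof.
by move=> oU Ux UP; apply: filterS UP _; exact: open_nbhs_nbhs.
Qed.

(** Near [x] the increment of [h] vanishes identically, hence is o(id), and the zero map is the
    differential. *)
Lemma near0_differentiable (R : realType) (V W : normedModType R)
    (h : V -> W) x :
  (\forall z \near x, h z = 0) -> differentiable h x.
Proof.
move=> h0.
have hE : h \o shift x = cst (h x) + (\0 : {linear V -> W}) +o_ 0 id.
  apply/eqaddoP => _/posnumP[e]; near=> z.
  rewrite !fctE /= (nbhs_singleton h0) !addr0 subr0.
  have -> : h (z + x) = 0 by near: z; move: h0; rewrite (near_shift 0) subr0.
  by rewrite normr0 mulr_ge0.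
apply/diff_locallyP.
have -> : ('d h x : V -> W) = 0.
  by rewrite (diff_unique _ hE) //; apply: cst_continuous.
by split => //; exact: cst_continuous.
Unshelve. all: by end_near. Qed.

(** Write g = f + (g - f), where the second summand vanishes near [x]. *)
Lemma near_eq_differentiable (R : realType) (V W : normedModType R)
    (f g : V -> W) x :
  (\forall z \near x, f z = g z) -> differentiable f x -> differentiable g x.
Proof.
move=> fg df; have -> : g = f + (g - f) by rewrite addrC subrK.
apply: differentiableD => //; apply: near0_differentiable.
by apply: filterS fg => z fgz; rewrite !fctE fgz subrr.
Qed.

Lemma near_eq_diff (R : realType) (V W : normedModType R)
    (f g : V -> W) x v :
  (\forall z \near x, f z = g z) -> differentiable f x -> 'd f x v = 'd g x v.
Proof.
move=> fg df; rewrite -!deriveE //; last exact: near_eq_differentiable df.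
exact: near_eq_derive.
Qed.

(** As [U] is open, equality on [U] is equality near each of its points and so passes to
    differentials; the induction therefore ranges over all pairs of functions. *)
Lemma eq_cont_diff (R : realType) (V W : normedModType R) k (U : set V)
    (f g : V -> W) :
  open U -> (forall x, U x -> f x = g x) -> cont_diff k U f -> cont_diff k U g.
Proof.
move=> oU; elim: k f g => [|k IHk] f g fg /=.
  move=> cf x Ux; suff : g @ x --> f x by rewrite fg.
  apply: cvg_trans (cf x Ux); apply: near_eq_cvg.
  exact: open_near fg.
move=> [df cdf]; split => [x Ux|v].
  by apply: near_eq_differentiable (df x Ux); exact: open_near fg.
apply: IHk (cdf v) => x Ux.
by apply: near_eq_diff (df x Ux); exact: open_near fg.
Qed.

Lemma cont_diffD (R : realType) (V W : normedModType R) k (U : set V)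
    (f g : V -> W) :
  open U -> cont_diff k U f -> cont_diff k U g -> cont_diff k U (f + g).
Proof.
move=> oU; elim: k f g => [|k IHk] f g /=.
  by move=> cf cg x Ux; apply: continuousD; [exact: cf|exact: cg].
move=> [df cdf] [dg cdg]; split => [x Ux|v].
  by apply: differentiableD; [exact: df|exact: dg].
apply: eq_cont_diff (IHk _ _ (cdf v) (cdg v)) => // x Ux.
by rewrite diffD; [|exact: df|exact: dg].
Qed.

Lemma smooth_on_differentiable (R : realType) (V W : normedModType R)
    (U : set V) (f : V -> W) x :
  smooth_on U f -> U x -> differentiable f x.
Proof. by move=> /(_ 1) [df _]; exact: df. Qed.

Lemma smooth_on_diff (R : realType) (V W : normedModType R)
    (U : set V) (f : V -> W) v :
  smooth_on U f -> smooth_on U (fun x => 'd f x v).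
Proof. by move=> sf k; have [_] := sf k.+1; exact. Qed.

(** * Calculus of smooth functions on an open set *)

Section SmoothOn.
Variables (R : realType) (V : normedModType R) (U : set V).
Hypothesis oU : open U.

Lemma smooth_on_derive (W : normedModType R) (f : V -> W) v :
  smooth_on U f -> smooth_on U ('D_v f).
Proof.
move=> sf k; apply: eq_cont_diff (smooth_on_diff v sf k) => // x Ux.
by rewrite deriveE //; exact: smooth_on_differentiable.
Qed.

(** Leibniz rule and induction on the order. Both factors are kept smooth throughout, so that the
    induction hypothesis applies to the functions and to their derivatives alike. *)
Lemma smooth_onM (f g : V -> R^o) :
  smooth_on U f -> smooth_on U g -> smooth_on U (f * g).
Proof.
move=> sf sg k; elim: k f g sf sg => [|k IHk] f g sf sg /=.
  by move=> x Ux; apply: continuousM; [exact: (sf 0)|exact: (sg 0)].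
have df x : U x -> differentiable f x by exact: smooth_on_differentiable.
have dg x : U x -> differentiable g x by exact: smooth_on_differentiable.
split => [x Ux|v].
  by apply: differentiableM; [exact: df|exact: dg].
apply: eq_cont_diff (cont_diffD oU (IHk _ _ sf (smooth_on_diff v sg))
  (IHk _ _ sg (smooth_on_diff v sf))) => // x Ux.
by rewrite diffM; [|exact: df|exact: dg].
Qed.

Lemma smooth_on_cst (W : normedModType R) (c : W) : smooth_on U (cst c).
Proof.
move=> k; elim: k c => [|k IHk] c; first by move=> x _; exact: cst_continuous.
split => [x _|v]; first exact: differentiable_cst.
by apply: eq_cont_diff (IHk 0) => // x Ux; rewrite diff_cst.
Qed.

(** [L] has the same differential [l] at every point, so the derivative of [f \o L] along [v] is
    again a composite with [L], now of the derivative of [f] along [l v]. *)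
Lemma smooth_on_comp (V' W : normedModType R) (U' : set V') (f : V' -> W)
    (L : V -> V') (l : V -> V') :
  (forall x, is_diff x L l) -> (forall x, U x -> U' (L x)) ->
  smooth_on U' f -> smooth_on U (f \o L).
Proof.
move=> dL UL + k; elim: k f => [|k IHk] f sf.
  move=> x Ux; apply: continuous_comp; last exact/(sf 0)/UL.
  exact/differentiable_continuous/ex_diff.
have df x : U x -> differentiable f (L x).
  by move=> Ux; apply: (@smooth_on_differentiable); [exact: sf|exact: UL].
split => [x Ux|v]; first by apply: differentiable_comp => //; exact: df.
have sdf : smooth_on U' (fun x => 'd f x (l v)).
  exact: smooth_on_diff.
apply: eq_cont_diff (IHk _ sdf) => // x Ux.
by rewrite diff_comp //= ?diff_val //; exact: df.
Qed.

End SmoothOn.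

(** A directional derivative depends only on the increments along one line, so functions on
    different spaces can be compared. This is how derivatives on a block of coordinates reduce to
    derivatives on a factor. *)
Lemma eq_derive_increment (R : realType) (V V' W : normedModType R)
    (f : V -> W) (g : V' -> W) x v x' v' :
  (forall h : R, f (h *: v + x) - f x = g (h *: v' + x') - g x') ->
  'D_v f x = 'D_v' g x'.
Proof.
move=> fg; rewrite /derive.
suff -> : (fun h => h^-1 *: ((f \o shift x) (h *: v) - f x)) =
          (fun h => h^-1 *: ((g \o shift x') (h *: v') - g x')) by [].
by apply/funext => h /=; rewrite fg.
Qed.

Lemma eq_derive_line (R : realType) (V V' W : normedModType R)
    (f : V -> W) (g : V' -> W) x v x' v' :
  (forall h : R, f (h *: v + x) = g (h *: v' + x')) -> 'D_v f x = 'D_v' g x'.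
Proof.
move=> fg; apply: eq_derive_increment => h; rewrite fg.
by have := fg 0; rewrite !scale0r !add0r => ->.
Qed.

(** * Positively homogeneous functions away from the origin *)

Section PositiveHomogeneity.
Variables (R : realType) (m : nat).
Implicit Types (f : 'rV[R]_m -> R^o) (z v : 'rV[R]_m).

Definition nonzero : set 'rV[R]_m := [set z | z != 0].

Lemma open_nonzero : open nonzero.
Proof.
have -> : nonzero = ~` [set 0].
  by apply/seteqP; split => z /= /eqP.
apply: closed_openC; apply: accessible_closed_set1.
exact/hausdorff_accessible/norm_hausdorff.
Qed.

(** The origin is excluded because Finsler metrics are smooth only off the zero section, so their
    derivatives are controlled only there. *)
Definition pos_homogeneous k f := forall (a : R) z, 0 < a -> z != 0 ->
  f (a *: z) = a ^+ k * f z.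

Lemma smooth_on_pderiv f a :
  smooth_on nonzero f -> smooth_on nonzero (pderiv a f : _ -> R^o).
Proof. exact: (smooth_on_derive open_nonzero (delta_mx 0 a)). Qed.

Lemma deriveE_pderiv f z v : differentiable f z ->
  'D_v f z = \sum_a v 0 a * pderiv a f z.
Proof.
move=> df; rewrite deriveE // {1}(row_sum_delta v) linear_sum /=.
by apply: eq_bigr => a _; rewrite linearZ /= /pderiv deriveE.
Qed.

(** The sum is the radial derivative, that is, the derivative at x = 1 of f(x z) = x^k f(z). *)
Lemma euler k f z : pos_homogeneous k f -> z != 0 -> differentiable f z ->
  \sum_a z 0 a * pderiv a f z = k%:R * f z.
Proof.
move=> hf z0 df; rewrite -deriveE_pderiv //.
have -> : 'D_z f z = 'D_1 ((fun x => x ^+ k * f z) : R^o -> R^o) (1 : R^o).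
  have -> : 'D_z f z = 'D_1 ((fun x => f (x *: z)) : R^o -> R^o) (1 : R^o).
    apply: eq_derive_line => h /=.
    by rewrite scalerDl scale1r -scalerA scale1r.
  apply: near_eq_derive; near=> x; apply: hf => //.
  near: x; exact: (@lt_nbhsr R 0 1 ltr01).
have -> : (fun x : R^o => x ^+ k * f z : R^o) = (f z *: @GRing.exp R ^~ k).
  by apply/funext => x; rewrite fctE mulrC.
rewrite (deriveZ _ (@exprn_derivable R k 1 1)).
by rewrite exp_derive expr1n -[LHS]/(f z * (k%:R * 1 * 1)) !mulr1 mulrC.
Unshelve. all: by end_near. Qed.

(** Differentiate x |-> f(c x) in two ways: the chain rule gives c times the derivative at c z,
    homogeneity gives c^(k+1) times the derivative at z. Then cancel c. *)
Lemma pos_homogeneous_pderiv k f a : pos_homogeneous k.+1 f ->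
  (forall z, z != 0 -> differentiable f z) -> pos_homogeneous k (pderiv a f).
Proof.
move=> hf df c z c0 z0; apply: (mulfI (lt0r_neq0 c0)).
have cz0 : c *: z != 0 by rewrite scaler_eq0 negb_or lt0r_neq0.
rewrite mulrA -exprS /pderiv; set v := delta_mx 0 a.
transitivity ('D_v (fun x => f (c *: x)) z).
  transitivity ('D_(c *: v) f (c *: z)).
    by rewrite !deriveE ?linearZ //; exact: df.
  apply: eq_derive_line => h.
  by rewrite scalerDr !scalerA mulrC.
transitivity ('D_v (c ^+ k.+1 *: f) z).
  apply: near_eq_derive; apply: (open_near open_nonzero) => // x x0.
  by rewrite fctE hf.
by rewrite deriveZ //; exact/diff_derivable/df.
Qed.

End PositiveHomogeneity.

(** * Local constancy and connectedness *)

Lemma locally_constant_connected (T : topologicalType) (S : Type) (f : T -> S)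
    (A : set T) :
  connected A -> (forall x, A x -> \forall y \near x, f y = f x) ->
  forall x y, A x -> A y -> f x = f y.
Proof.
move=> cA lf x y Ax Ay.
(* The level set of [f] through [x] is open and closed in [A]. Since [f] is locally constant only at
   points of [A], both are witnessed by interiors in the ambient space. *)
suff AE : A `&` [set z | f z = f x] = A by move: Ay; rewrite -AE => -[].
apply: cA; first by exists x.
- exists [set z | f z = f x]^°; first exact: open_interior.
  apply/seteqP; split => z [Az fz]; split => //; last exact: interior_subset fz.
  by apply: filterS (lf z Az) => w /= fw; rewrite fw.
- exists (~` [set z | f z <> f x]^°); first exact/open_closedC/open_interior.
  apply/seteqP; split => z [Az fz]; split => //.
    by move=> /interior_subset.
  apply: contrapT => nfz; apply: fz.
  by apply: filterS (lf z Az) => w /= fw; rewrite fw.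
Qed.

(** Mean value theorem on the segment from [x] to [y], which stays in a ball contained in [U]. *)
Lemma derive0_near_constant (R : realType) (V : normedModType R) (U : set V)
    (f : V -> R^o) :
  open U -> (forall x, U x -> differentiable f x) ->
  (forall x v, U x -> 'D_v f x = 0) ->
  forall x, U x -> \forall y \near x, f y = f x.
Proof.
move=> oU df f0 x Ux.
have /nbhs_ballP[e /= e0 xeU] : nbhs x U by exact: open_nbhs_nbhs.
near=> y.
pose L (t : R) : V := t *: (y - x) + x.
have UL (t : R) : t \in `[0, 1] -> U (L t).
  rewrite in_itv /= => /andP[t0 t1]; apply: xeU.
  rewrite -ball_normE /= /L opprD addrCA subrr addr0 normrN normrZ ger0_norm //.
  apply: (@le_lt_trans _ _ `|y - x|); first by rewrite ler_piMl.
  near: y; have := @nbhsx_ballx _ _ x _ e0; rewrite -ball_normE.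
  by apply: filterS => y /=; rewrite distrC.
have dL t : differentiable L t.
  by apply: differentiableD; first exact: differentiableZl.
have dfL (t : R) : t \in `[0, 1] -> differentiable (f \o L) t.
  by move=> t01; apply: differentiable_comp => //; exact/df/UL.
have [|t t01|c _] := @MVT_segment R (f \o L) (fun=> 0) 0 1 ler01.
- move=> t /subset_itv_oo_cc t01.
  apply: DeriveDef; first exact/derivable1_diffP/dfL.
  rewrite -(f0 (L t) (y - x) (UL _ t01)); apply: eq_derive_line => h /=.
  by rewrite /L scalerDl addrA scaler1.
- apply: continuous_in_subspaceT => s /[!inE] /= s01.
  exact/differentiable_continuous/dfL.
- by rewrite mul0r /= /L scale0r add0r scale1r subrK => /subr0_eq.
Unshelve. all: by end_near. Qed.

(** * Differentiating Euler's identity *)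

Section Euler.
Variables (R : realType) (m : nat).
Implicit Types (f : 'rV[R]_m -> R^o) (z v : 'rV[R]_m).

Lemma derive_coord a z v :
  'D_v (fun x : 'rV[R]_m => x 0 a : R^o) z = v 0 a.
Proof.
have := derive_mx (@derivable_id _ _ z v).
by rewrite derive_id => {2}->; rewrite mxE.
Qed.

(** Differentiating the identity for degree one in direction c gives the derivative of [f] on both
    sides, plus the sum in question. The contracted index belongs to the inner derivative, so no
    exchange of derivatives occurs. *)
Lemma euler_deriv f z c : pos_homogeneous 1 f -> z != 0 ->
  (forall x, x != 0 -> differentiable f x) ->
  (forall a, differentiable (pderiv a f) z) ->
  \sum_a z 0 a * pderiv c (pderiv a f) z = 0.
Proof.
move=> hf z0 df ddf.
pose g a : 'rV[R]_m -> R^o := fun x => x 0 a.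
have dg a : derivable (g a) z (delta_mx 0 c).
  exact/diff_derivable/differentiable_coord.
have dpf a : derivable (pderiv a f : _ -> R^o) z (delta_mx 0 c).
  exact/diff_derivable/ddf.
have : pderiv c f z =
    'D_(delta_mx 0 c) (\sum_a (g a * (pderiv a f : _ -> R^o))) z.
  apply: near_eq_derive; apply: (open_near (@open_nonzero _ _)) => // x x0.
  rewrite -[LHS]mul1r -[1]/1%:R -(euler hf x0) ?fct_sumE; last exact: df.
  by [].
rewrite derive_sum; last by move=> a; exact: derivableM.
under eq_bigr => a _ do rewrite deriveM // derive_coord mxE eqxx /=.
rewrite big_split /= [X in _ = _ + X](bigD1 c) //= eqxx.
rewrite [X in _ = _ + (_ + X)]big1 => [|a /negbTE ->]; last by rewrite scaler0.
rewrite addr0 [_ *: _]mulr1 -[LHS]add0r => /addIr; exact: esym.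
Qed.

End Euler.

(** * Algebra of the Matsumoto torsion at one point *)

Section Fundamental.
Variables (R : realType) (m : nat) (Phi : 'rV[R]_m -> R).
Implicit Types (y z u v : 'rV[R]_m).

Lemma quad_formE (g : 'M[R]_m) u v :
  (u *m g *m v^T) 0 0 = \sum_a u 0 a * \sum_b g a b * v 0 b.
Proof.
rewrite -mulmxA mxE; apply: eq_bigr => a _; rewrite mxE; congr (_ * _).
by apply: eq_bigr => b _; rewrite mxE.
Qed.

Lemma mean_cartan_contract y u :
  (forall b c, \sum_a u 0 a * cartan Phi y a b c = 0) ->
  \sum_a u 0 a * mean_cartan Phi y a = 0.
Proof.
move=> uC; under eq_bigr do rewrite mulr_sumr.
rewrite exchange_big big1 // => b _; under eq_bigr do rewrite mulr_sumr.
rewrite exchange_big big1 // => c _; under eq_bigr do rewrite mulrCA.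
by rewrite -mulr_sumr uC mulr0.
Qed.

Lemma angular_contract y u :
  \sum_a u 0 a * \sum_b u 0 b * angular Phi y a b =
  (u *m fundamental Phi y *m u^T) 0 0 -
  (Phi y ^+ 2)^-1 * ((u *m fundamental Phi y *m y^T) 0 0) ^+ 2.
Proof.
have lowE : (u *m fundamental Phi y *m y^T) 0 0 =
    \sum_a u 0 a * lowered Phi y a by rewrite quad_formE.
rewrite lowE quad_formE.
under eq_bigr => a _.
  under eq_bigr => b _ do rewrite /angular mulrBr.
  rewrite sumrB mulrBr.
  over.
rewrite sumrB; congr (_ - _).
  by apply: eq_bigr => a _; congr (_ * _); apply: eq_bigr => b _; rewrite mulrC.
rewrite [X in _ = _ * X]expr2 mulr_suml mulr_sumr; apply: eq_bigr => a _.
move: (lowered Phi y) => L.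
rewrite !mulr_sumr; apply: eq_bigr => b _; ring.
Qed.

(** Here y = u + v abstracts the splitting (y1, 0) + (0, y2). Orthogonality is asked in both orders
    because symmetry of [fundamental] is never established; likewise the Cartan tensor is contracted
    in its first index only. *)
Lemma matsumoto0_cartan0 y u v : u != 0 -> v != 0 -> y = u + v ->
  posdef (fundamental Phi y) ->
  u *m fundamental Phi y *m v^T = 0 -> v *m fundamental Phi y *m u^T = 0 ->
  (y *m fundamental Phi y *m y^T) 0 0 = Phi y ^+ 2 ->
  (forall b c, \sum_a u 0 a * cartan Phi y a b c = 0) ->
  (forall a b c, matsumoto Phi y a b c = 0) ->
  forall a b c, cartan Phi y a b c = 0.
Proof.
move=> u0 v0 yuv gpos guv gvu gyy uC M0.
set k := (m%:R + 1 : R)^-1.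
have k0 : k != 0 by rewrite invr_neq0 // gt_eqF // ltr_wpDl.
pose g (s t : 'rV[R]_m) := (s *m fundamental Phi y *m t^T) 0 0.
have X0 : 0 < g u u := gpos _ u0.
have Y0 : 0 < g v v := gpos _ v0.
(* Orthogonality gives g(u, y) = g(u, u), so that h(u, u) = X - X^2 / (X + Y) with X = g(u, u) and Y
   = g(v, v). *)
have guy : g u y = g u u.
  by rewrite /g {2}yuv linearD /= mulmxDr guv addr0.
have Phi2E : Phi y ^+ 2 = g u u + g v v.
  rewrite -gyy {1 3}yuv linearD /= !mulmxDl !mulmxDr.
  by rewrite guv gvu addr0 add0r [LHS]mxE.
have huu : \sum_a u 0 a * \sum_b u 0 b * angular Phi y a b != 0.
  rewrite angular_contract -/(g u u) -/(g u y) guy Phi2E.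
  have -> : g u u - (g u u + g v v)^-1 * g u u ^+ 2 =
            g u u * g v v / (g u u + g v v).
    by field; rewrite gt_eqF // addr_gt0.
  by rewrite gt_eqF // divr_gt0 ?mulr_gt0 ?addr_gt0.
have I0 c : mean_cartan Phi y c = 0.
  have : \sum_a u 0 a * \sum_b u 0 b * matsumoto Phi y a b c = 0.
    by rewrite big1 // => a _; rewrite big1 ?mulr0 // => b _; rewrite M0 mulr0.
  have uI := mean_cartan_contract uC.
  pose T a := \sum_b u 0 b * angular Phi y a b.
  pose H := \sum_b u 0 b * angular Phi y b c.
  have inner a : \sum_b u 0 b * matsumoto Phi y a b c =
      \sum_b u 0 b * cartan Phi y a b c -
      k * (mean_cartan Phi y a * H + mean_cartan Phi y c * T a).
    rewrite /matsumoto -/k /T /H {T H}.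
    move: (mean_cartan Phi y) uI (angular Phi y) (cartan Phi y) => I uI h C.
    (* Contraction over b kills I_b h_ac; this term is reinserted as a zero so that the sums agree
       term by term. *)
    have hI : h a c * \sum_b u 0 b * I b = 0 by rewrite uI mulr0.
    rewrite -[X in k * (X + _)]addr0 -[X in k * (_ + X + _)]hI.
    rewrite !mulr_sumr -!big_split mulr_sumr -sumrB /=.
    by apply: eq_bigr => b _; ring.
  under eq_bigr => a _ do
    rewrite inner mulrBr [u 0 a * (k * _)]mulrCA mulrDr
            [u 0 a * (_ * H)]mulrA [u 0 a * (_ * T a)]mulrCA.
  (* Contraction over a kills I_a H as well, which leaves the Cartan term and I_c h(u, u). *)
  rewrite sumrB -mulr_sumr big_split /= -mulr_sumr -mulr_suml uI mul0r add0r.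
  under eq_bigr do rewrite mulr_sumr.
  (* In the Cartan term the sum over the first index is taken first and vanishes. *)
  rewrite exchange_big big1 => [|b _]; last first.
    by under eq_bigr do rewrite mulrCA; rewrite -mulr_sumr uC mulr0.
  rewrite sub0r => /eqP.
  by rewrite oppr_eq0 !mulf_eq0 (negbTE k0) (negbTE huu) orbF => /eqP.
move=> a b c; have := M0 a b c.
by rewrite /matsumoto !I0 !mul0r !addr0 mulr0 subr0.
Qed.

End Fundamental.

(** * Fibre tensors of a function whose square is smooth and homogeneous *)

Section Homogeneous.
Variables (R : realType) (m : nat) (Phi : 'rV[R]_m -> R).
Let G : 'rV[R]_m -> R^o := fun z => Phi z ^+ 2.
Hypothesis smoothG : smooth_on (@nonzero R m) G.
Hypothesis homG : pos_homogeneous 2 G.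

Let dG z : z != 0 -> differentiable G z.
Proof. by move=> z0; apply: smooth_on_differentiable smoothG _. Qed.

Let smoothD1 b : smooth_on (@nonzero R m) (pderiv b G : _ -> R^o).
Proof. exact: smooth_on_pderiv. Qed.

Let smoothD2 a b : smooth_on (@nonzero R m) (pderiv a (pderiv b G) : _ -> R^o).
Proof. exact: smooth_on_pderiv. Qed.

Let dD1 b z : z != 0 -> differentiable (pderiv b G : _ -> R^o) z.
Proof. by move=> z0; apply: smooth_on_differentiable (smoothD1 b) _. Qed.

Let dD2 a b z : z != 0 -> differentiable (pderiv a (pderiv b G) : _ -> R^o) z.
Proof. by move=> z0; apply: smooth_on_differentiable (smoothD2 a b) _. Qed.

Let homD1 b : pos_homogeneous 1 (pderiv b G).
Proof. by apply: pos_homogeneous_pderiv homG _ => z z0; exact: dG. Qed.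

Let fundamentalE a b :
  (fun z => fundamental Phi z a b) = 2^-1 *: (pderiv a (pderiv b G) : _ -> R^o).
Proof. by apply/funext => z; rewrite mxE. Qed.

Let cartanE z a b c : z != 0 ->
  cartan Phi z a b c = 2^-1 * (2^-1 * pderiv c (pderiv a (pderiv b G)) z).
Proof.
move=> z0; rewrite /cartan fundamentalE {1}/pderiv deriveZ //.
exact/diff_derivable/dD2.
Qed.

(** Euler's identity twice: for the first derivatives of [G], of degree 1, then for [G], whose
    degree 2 cancels the factor 1/2. *)
Lemma fundamental_quad_form (z : 'rV[R]_m) : z != 0 ->
  (z *m fundamental Phi z *m z^T) 0 0 = Phi z ^+ 2.
Proof.
move=> z0; rewrite quad_formE; under eq_bigr do rewrite mulr_sumr.
rewrite exchange_big /=.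
transitivity (\sum_b z 0 b * (2^-1 * pderiv b G z)).
  apply: eq_bigr => b _; rewrite -[pderiv b G z]mul1r -[1]/1%:R.
  rewrite -(euler (homD1 b) z0 (dD1 b z0)) !mulr_sumr.
  by apply: eq_bigr => a _; rewrite mxE; ring.
under eq_bigr do rewrite mulrCA.
by rewrite -mulr_sumr (euler homG z0 (dG z0)) mulKf ?pnatr_eq0.
Qed.

(** The derivative of [G] in direction b has degree 1, so its second derivatives annihilate [z]. *)
Lemma cartan_contract (z : 'rV[R]_m) b c :
  z != 0 -> \sum_a z 0 a * cartan Phi z a b c = 0.
Proof.
move=> z0; under eq_bigr do rewrite cartanE // mulrCA [z 0 _ * _]mulrCA.
rewrite -!mulr_sumr (euler_deriv _ (homD1 b) z0) ?mulr0 //.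
- by move=> x x0; exact: dD1.
- by move=> a; exact: dD2.
Qed.

(** The Cartan tensor is half the gradient of the entries of [fundamental], which are therefore
    locally constant off the origin. *)
Lemma fundamental_constant (A : set 'rV[R]_m) x y :
  (forall (z : 'rV[R]_m) a b c, z != 0 -> cartan Phi z a b c = 0) ->
  connected A -> A `<=` @nonzero R m -> A x -> A y ->
  fundamental Phi x = fundamental Phi y.
Proof.
move=> C0 cA A0 Ax Ay; apply/matrixP => a b.
pose f : 'rV[R]_m -> R^o := fun z => fundamental Phi z a b.
have df z : z != 0 -> differentiable f z.
  by move=> z0; rewrite /f fundamentalE; exact/differentiableZ/dD2.
apply: (locally_constant_connected (f := f) cA) => // z /A0 z0.
apply: derive0_near_constant z0 => // [|w v w0]; first exact: open_nonzero.
rewrite deriveE_pderiv; last exact: df.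
rewrite big1 // => c _.
have /eqP := C0 w a b c w0.
by rewrite mulf_eq0 invr_eq0 pnatr_eq0 /= => /eqP ->; rewrite mulr0.
Qed.

End Homogeneous.

(** * Multiplication of a metric by a constant warping factor *)

Section Scaling.
Variables (R : realType) (m : nat) (Phi : 'rV[R]_m -> R) (k : R).
Hypothesis smoothPhi : smooth_on (@nonzero R m) (Phi : _ -> R^o).
Hypothesis homPhi : forall (a : R) z, 0 < a -> Phi (a *: z) = a * Phi z.

Lemma smooth_on_scaled_sqr :
  smooth_on (@nonzero R m) ((fun z => (k * Phi z) ^+ 2) : _ -> R^o).
Proof.
have sk := smooth_on_cst (@open_nonzero R m) (k : R^o).
have skPhi := smooth_onM (@open_nonzero R m) sk smoothPhi.
have := smooth_onM (@open_nonzero R m) skPhi skPhi.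
by congr smooth_on; apply/funext => z.
Qed.

Lemma scaled_sqr_homogeneous :
  pos_homogeneous 2 (fun z => (k * Phi z) ^+ 2 : R^o).
Proof. by move=> a z a0 _; rewrite homPhi //; ring. Qed.

Lemma fundamental_scaled (z : 'rV[R]_m) : z != 0 ->
  fundamental (fun x => k * Phi x) z = k ^+ 2 *: fundamental Phi z.
Proof.
move=> z0; 
have sP2 : smooth_on (@nonzero R m) ((fun x => Phi x ^+ 2) : _ -> R^o).
  have := smooth_onM (@open_nonzero R m) smoothPhi smoothPhi.
  by congr smooth_on; apply/funext => x; rewrite expr2.
apply/matrixP => a b; rewrite !mxE [RHS]mulrCA; congr (_ * _).
have sb := smooth_on_pderiv b sP2.
transitivity ('D_(delta_mx 0 a) (k ^+ 2 *: 'D_(delta_mx 0 b)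
    ((fun x => Phi x ^+ 2) : 'rV[R]_m -> R^o)) z).
  (* The outer derivative sees the inner one near [z], so the scalar is pulled out at all nonzero
     vectors. *)
  apply: near_eq_derive; apply: (open_near (@open_nonzero R m)) => // x x0.
  rewrite fctE -deriveZ; last first.
    by apply/diff_derivable; apply: smooth_on_differentiable sP2 _.
  by apply: eq_derive_line => h; rewrite exprMn.
rewrite deriveZ //.
by apply/diff_derivable; apply: smooth_on_differentiable sb _.
Qed.

End Scaling.

(** * Sums of functions of separate variables *)

Section Blocks.
Variables (R : realType) (n1 n2 : nat).
Implicit Types (A : 'rV[R]_n1 -> R) (B : 'rV[R]_n2 -> R).
Implicit Types (y : 'rV[R]_(n1 + n2)).

(** The summand that depends on the other block cancels in the increment. *)
Lemma pderiv_lshift A B a y :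
  pderiv (lshift n2 a) (fun z => A (lsubmx z) + B (rsubmx z)) y =
  pderiv a A (lsubmx y).
Proof.
apply: eq_derive_increment => h.
rewrite delta_mx_lshift !linearD !linearZ /= row_mxKl row_mxKr scaler0 add0r.
by rewrite addrACA subrr addr0.
Qed.

Lemma pderiv_rshift A B b y :
  pderiv (rshift n1 b) (fun z => A (lsubmx z) + B (rsubmx z)) y =
  pderiv b B (rsubmx y).
Proof.
apply: eq_derive_increment => h.
rewrite delta_mx_rshift !linearD !linearZ /= row_mxKl row_mxKr scaler0 add0r.
by rewrite addrACA subrr add0r.
Qed.

Lemma pderiv_lshift_lsubmx A a y :
  pderiv (lshift n2 a) (fun z => A (lsubmx z)) y = pderiv a A (lsubmx y).
Proof.
apply: eq_derive_line => h.
by rewrite delta_mx_lshift linearD linearZ /= row_mxKl.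
Qed.

Lemma pderiv_rshift_rsubmx B b y :
  pderiv (rshift n1 b) (fun z => B (rsubmx z)) y = pderiv b B (rsubmx y).
Proof.
apply: eq_derive_line => h.
by rewrite delta_mx_rshift linearD linearZ /= row_mxKr.
Qed.

Lemma pderiv_cst m (c : R) a (z : 'rV[R]_m) : pderiv a (fun=> c) z = 0.
Proof. exact: derive_cst. Qed.

Lemma pderiv_rshift_lsubmx A b y :
  pderiv (rshift n1 b) (fun z => A (lsubmx z)) y = 0.
Proof.
rewrite -(pderiv_cst (0 : R) b (rsubmx y)); apply: eq_derive_increment => h.
by rewrite delta_mx_rshift linearD linearZ /= row_mxKl scaler0 add0r !subrr.
Qed.

Lemma pderiv_lshift_rsubmx B a y :
  pderiv (lshift n2 a) (fun z => B (rsubmx z)) y = 0.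
Proof.
rewrite -(pderiv_cst (0 : R) a (lsubmx y)); apply: eq_derive_increment => h.
by rewrite delta_mx_lshift linearD linearZ /= row_mxKr scaler0 add0r !subrr.
Qed.

Variables (Phi1 : 'rV[R]_n1 -> R) (Phi2 : 'rV[R]_n2 -> R).
Variable Phi : 'rV[R]_(n1 + n2) -> R.
Hypothesis PhiE : forall y,
  Phi y ^+ 2 = Phi1 (lsubmx y) ^+ 2 + Phi2 (rsubmx y) ^+ 2.

Lemma fundamental_block y : fundamental Phi y =
  block_mx (fundamental Phi1 (lsubmx y)) 0 0 (fundamental Phi2 (rsubmx y)).
Proof.
have PhiE' : (fun z => Phi z ^+ 2) =
    (fun z => (fun x => Phi1 x ^+ 2) (lsubmx z) +
              (fun x => Phi2 x ^+ 2) (rsubmx z)) by exact/funext.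
(* The first derivatives are identified as functions, so that they can be differentiated again. *)
have dl b : pderiv (lshift n2 b) (fun z => Phi z ^+ 2) =
    fun z => pderiv b (fun x => Phi1 x ^+ 2) (lsubmx z).
  rewrite PhiE'; apply/funext => z.
  exact: (pderiv_lshift (fun x => Phi1 x ^+ 2) (fun x => Phi2 x ^+ 2)).
have dr b : pderiv (rshift n1 b) (fun z => Phi z ^+ 2) =
    fun z => pderiv b (fun x => Phi2 x ^+ 2) (rsubmx z).
  rewrite PhiE'; apply/funext => z.
  exact: (pderiv_rshift (fun x => Phi1 x ^+ 2) (fun x => Phi2 x ^+ 2)).
apply/matrixP => a b; rewrite mxE.
case: (split_ordP a) => i ->; case: (split_ordP b) => j ->.
- rewrite block_mxEul mxE dl.
  by rewrite (pderiv_lshift_lsubmx (pderiv j (fun x => Phi1 x ^+ 2))).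
- rewrite block_mxEur mxE dr.
  by rewrite (pderiv_lshift_rsubmx (pderiv j (fun x => Phi2 x ^+ 2))) mulr0.
- rewrite block_mxEdl mxE dl.
  by rewrite (pderiv_rshift_lsubmx (pderiv j (fun x => Phi1 x ^+ 2))) mulr0.
- rewrite block_mxEdr mxE dr.
  by rewrite (pderiv_rshift_rsubmx (pderiv j (fun x => Phi2 x ^+ 2))).
Qed.

Lemma cartan_lshift y i j k :
  cartan Phi y (lshift n2 i) (lshift n2 j) (lshift n2 k) =
  cartan Phi1 (lsubmx y) i j k.
Proof.
rewrite /cartan -(pderiv_lshift_lsubmx (fun x => fundamental Phi1 x i j)).
congr (_ * _); apply: (@eq_derive_line R) => h.
by rewrite fundamental_block block_mxEul.
Qed.

Lemma cartan_rshift y i j k :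
  cartan Phi y (rshift n1 i) (rshift n1 j) (rshift n1 k) =
  cartan Phi2 (rsubmx y) i j k.
Proof.
rewrite /cartan -(pderiv_rshift_rsubmx (fun x => fundamental Phi2 x i j)).
congr (_ * _); apply: (@eq_derive_line R) => h.
by rewrite fundamental_block block_mxEdr.
Qed.

(** Only indices a of the first block contribute. If b and c also lie there, the sum is that of the
    first factor; otherwise every term is a mixed component. *)
Lemma cartan_block_contract y :
  (forall j k, \sum_i lsubmx y 0 i * cartan Phi1 (lsubmx y) i j k = 0) ->
  forall b c, \sum_a row_mx (lsubmx y) 0 0 a * cartan Phi y a b c = 0.
Proof.
move=> C1 b c; rewrite big_split_ord /= [X in _ + X]big1 ?addr0; last first.
  by move=> i _; rewrite row_mxEr mxE mul0r.
under eq_bigr do rewrite row_mxEl.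
case: (split_ordP b) => j ->.
  case: (split_ordP c) => k ->.
    by under eq_bigr do rewrite cartan_lshift.
  (* With c in the second block, an entry depending only on the first block is differentiated. *)
  rewrite big1 // => i _; rewrite /cartan.
  have -> : (fun z => fundamental Phi z (lshift n2 i) (lshift n2 j)) =
      (fun z => fundamental Phi1 (lsubmx z) i j).
    by apply/funext => z; rewrite fundamental_block block_mxEul.
  by rewrite (pderiv_rshift_lsubmx (fun x => fundamental Phi1 x i j)) !mulr0.
(* With b in the second block, the entry lies off the diagonal blocks and is identically 0. *)
rewrite big1 // => i _; rewrite /cartan.
have -> : (fun z => fundamental Phi z (lshift n2 i) (rshift n1 j)) = (fun=> 0).
  by apply/funext => z; rewrite fundamental_block block_mxEur mxE.
by rewrite pderiv_cst !mulr0.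
Qed.

Lemma posdef_block (g1 : 'M[R]_n1) (g2 : 'M[R]_n2) :
  posdef g1 -> posdef g2 -> posdef (block_mx g1 0 0 g2).
Proof.
move=> p1 p2 z z0; rewrite -(hsubmxK z) mul_row_block !mulmx0 addr0 add0r.
rewrite tr_row_mx mul_row_col mxE.
(* A nonzero vector may have one zero block, so each form is first bounded below by 0. *)
have p1' : 0 <= (lsubmx z *m g1 *m (lsubmx z)^T) 0 0.
  have [->|/p1/ltW//] := eqVneq (lsubmx z) 0.
  by rewrite !mul0mx mxE.
have p2' : 0 <= (rsubmx z *m g2 *m (rsubmx z)^T) 0 0.
  have [->|/p2/ltW//] := eqVneq (rsubmx z) 0.
  by rewrite !mul0mx mxE.
have [l0|/p1 l0] := eqVneq (lsubmx z) 0; last exact: ltr_pwDl.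
have [r0|/p2 r0] := eqVneq (rsubmx z) 0; last exact: ltr_wpDl.
by move: z0; rewrite -(hsubmxK z) l0 r0 row_mx0 eqxx.
Qed.

End Blocks.

(** * Restriction of a Finsler metric to one tangent space *)

Section FinslerFibre.
Variables (R : realType) (n : nat) (M : manifold R n) (F : finsler M).
Variables (i : chart_index M) (p : M).
Hypothesis ip : dom i p.

(** Joint smoothness in base point and vector is composed with the affine inclusion z |->
    ([chart i p], z). *)
Lemma smooth_on_fibre :
  smooth_on (@nonzero R n) ((fun z => F (tangent_at i p z)) : _ -> R^o).
Proof.
have invp : inv_chart i (chart i p) = p by rewrite chartK // inE.
have dL (z : 'rV[R]_n) : is_diff z (fun z => (chart i p, z)) (fun z => (0, z)).
  exact: is_diff_pair.
have := smooth_on_comp (@open_nonzero R n) dL _ (@metric_smooth _ _ _ F i).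
rewrite /comp /= invp; apply => z z0; split => //; exact: imageP.
Qed.

Lemma fibre_homogeneous (a : R) z : 0 < a ->
  F (tangent_at i p (a *: z)) = a * F (tangent_at i p z).
Proof.
move=> a0; rewrite -metric_homogeneous //; congr (F _); apply: eq_tangent => //.
apply/funext => j; rewrite /= /components_at.
by case: ifP => _; rewrite ?scaler0 // linearZ.
Qed.

End FinslerFibre.

(** * C-reducibility of a sum of two squares *)

Section Warped.
Variables (R : realType) (n1 n2 : nat).
Variables (Phi1 : 'rV[R]_n1 -> R) (Phi2 : 'rV[R]_n2 -> R).
Variable Phi : 'rV[R]_(n1 + n2) -> R.
Hypothesis PhiE : forall y,
  Phi y ^+ 2 = Phi1 (lsubmx y) ^+ 2 + Phi2 (rsubmx y) ^+ 2.
Hypothesis smooth1 :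
  smooth_on (@nonzero R n1) ((fun z => Phi1 z ^+ 2) : _ -> R^o).
Hypothesis smooth2 :
  smooth_on (@nonzero R n2) ((fun z => Phi2 z ^+ 2) : _ -> R^o).
Hypothesis hom1 : pos_homogeneous 2 (fun z => Phi1 z ^+ 2 : R^o).
Hypothesis hom2 : pos_homogeneous 2 (fun z => Phi2 z ^+ 2 : R^o).
Hypothesis posdef1 : forall z, z != 0 -> posdef (fundamental Phi1 z).
Hypothesis posdef2 : forall z, z != 0 -> posdef (fundamental Phi2 z).

Lemma posdef_fundamental y : slit_fibre y -> posdef (fundamental Phi y).
Proof.
move=> [l0 r0]; rewrite (fundamental_block PhiE).
by apply: posdef_block; [exact: posdef1|exact: posdef2].
Qed.

(** Euler's theorem is applied in each block, where smoothness and homogeneity are known. *)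
Lemma quad_form_fundamental y : slit_fibre y ->
  (y *m fundamental Phi y *m y^T) 0 0 = Phi y ^+ 2.
Proof.
move=> [l0 r0]; rewrite (fundamental_block PhiE) PhiE.
rewrite -[in LHS](hsubmxK y) row_mxKl row_mxKr.
rewrite mul_row_block !mulmx0 addr0 add0r tr_row_mx mul_row_col mxE.
rewrite (fundamental_quad_form smooth1 hom1 l0).
by rewrite (fundamental_quad_form smooth2 hom2 r0).
Qed.

Lemma C_reducible_cartan0 y : slit_fibre y ->
  (forall a b c, matsumoto Phi y a b c = 0) ->
  forall a b c, cartan Phi y a b c = 0.
Proof.
move=> sy M0; have [l0 r0] := sy.
have yuv : y = row_mx (lsubmx y) 0 + row_mx 0 (rsubmx y).
  by rewrite add_row_mx addr0 add0r hsubmxK.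
apply: (matsumoto0_cartan0 _ _ yuv) => //.
- by apply: contra_neq l0 => /(congr1 lsubmx); rewrite row_mxKl linear0.
- by apply: contra_neq r0 => /(congr1 rsubmx); rewrite row_mxKr linear0.
- exact: posdef_fundamental.
- rewrite (fundamental_block PhiE) mul_row_block !mulmx0 !mul0mx !addr0.
  by rewrite tr_row_mx mul_row_col trmx0 mulmx0 mul0mx addr0.
- rewrite (fundamental_block PhiE) mul_row_block !mulmx0 !mul0mx !add0r.
  by rewrite tr_row_mx mul_row_col trmx0 mulmx0 mul0mx addr0.
- exact: quad_form_fundamental.
- apply: (cartan_block_contract PhiE) => j k.
  exact: (cartan_contract smooth1 hom1).
Qed.

(** Vanishing of the Cartan tensor is transferred to the two factors, whose squares are smooth off
    the origin, and constancy is proved for each diagonal block. *)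
Lemma fundamental_constant_slit (A : set 'rV[R]_(n1 + n2)) x y :
  (forall z, slit_fibre z -> forall a b c, matsumoto Phi z a b c = 0) ->
  connected A -> A `<=` @slit_fibre R n1 n2 -> A x -> A y ->
  fundamental Phi x = fundamental Phi y.
Proof.
move=> M0 cA sA Ax Ay; have [lx0 rx0] := sA x Ax.
(* Completing [z] by the nonzero second block of [x] gives a point of the slit fibre. *)
have C1 (z : 'rV[R]_n1) a b c : z != 0 -> cartan Phi1 z a b c = 0.
  move=> z0; have := cartan_lshift PhiE (row_mx z (rsubmx x)) a b c.
  have sz : slit_fibre (row_mx z (rsubmx x)).
    by split; rewrite ?row_mxKl ?row_mxKr.
  by rewrite (C_reducible_cartan0 sz (M0 _ sz)) row_mxKl.
have C2 (z : 'rV[R]_n2) a b c : z != 0 -> cartan Phi2 z a b c = 0.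
  move=> z0; have := cartan_rshift PhiE (row_mx (lsubmx x) z) a b c.
  have sz : slit_fibre (row_mx (lsubmx x) z).
    by split; rewrite ?row_mxKl ?row_mxKr.
  by rewrite (C_reducible_cartan0 sz (M0 _ sz)) row_mxKr.
(* The projections of [A] are connected and avoid the origin. *)
have cl : connected (lsubmx @` A).
  by apply: connected_continuous_connected cA _; apply: continuous_subspaceT;
    exact: continuous_lsubmx.
have cr : connected (rsubmx @` A).
  by apply: connected_continuous_connected cA _; apply: continuous_subspaceT;
    exact: continuous_rsubmx.
rewrite !(fundamental_block PhiE).
have -> : fundamental Phi1 (lsubmx x) = fundamental Phi1 (lsubmx y).
  apply: (fundamental_constant smooth1 C1 cl); [|exact: imageP..].
  by move=> _ [z /sA[lz _] <-].
suff -> : fundamental Phi2 (rsubmx x) = fundamental Phi2 (rsubmx y) by [].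
apply: (fundamental_constant smooth2 C2 cr); [|exact: imageP..].
by move=> _ [z /sA[_ rz] <-].
Qed.

(** The form is read off from [fundamental] at any one point x of [A]; constancy moves it to y,
    where Euler's theorem recovers the square of [Phi]. *)
Lemma C_reducible_quadratic (A : set 'rV[R]_(n1 + n2)) :
  (forall z, slit_fibre z -> forall a b c, matsumoto Phi z a b c = 0) ->
  connected A -> A `<=` @slit_fibre R n1 n2 ->
  exists q : 'M[R]_(n1 + n2), [/\ q^T = q, posdef q &
    forall y, A y -> Phi y ^+ 2 = (y *m q *m y^T) 0 0].
Proof.
move=> M0 cA sA; case: (pselect (A !=set0)) => [[x Ax]|A0]; last first.
  (* For empty [A] any inner product serves; the standard one is taken. *)
  exists 1%:M; split => [|z z0|y Ay]; first exact: trmx1.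
    have [j zj0] := rV0Pn _ z0.
    rewrite mulmx1 mxE (bigD1 j) //= mxE ltr_pwDl //.
      by rewrite lt_def mulf_neq0 //= sqr_ge0.
    by apply: sumr_ge0 => k _; rewrite mxE sqr_ge0.
  by case: A0; exists y.
have gT (g : 'M[R]_(n1 + n2)) y :
    (y *m (2^-1 *: (g + g^T)) *m y^T) 0 0 = (y *m g *m y^T) 0 0.
  have yT : (y *m g^T *m y^T) 0 0 = (y *m g *m y^T) 0 0.
    have -> : y *m g^T *m y^T = (y *m g *m y^T)^T.
      by rewrite !trmx_mul trmxK mulmxA.
    by rewrite [LHS]mxE.
  rewrite -scalemxAr -scalemxAl mulmxDr mulmxDl mxE [X in _ * X]mxE yT.
  by field.
(* Symmetrizing avoids proving that second derivatives commute. *)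
exists (2^-1 *: (fundamental Phi x + (fundamental Phi x)^T)).
split => [|z z0|y Ay].
- by rewrite linearZ linearD /= trmxK addrC.
- by rewrite gT; exact: posdef_fundamental (sA _ Ax) _ z0.
- rewrite gT (fundamental_constant_slit M0 cA sA Ax Ay).
  by rewrite quad_form_fundamental //; exact: sA.
Qed.

End Warped.

Theorem theorem1 (R : realType) (n1 n2 : nat)
    (M1 : manifold R n1) (M2 : manifold R n2)
    (F1 : finsler M1) (F2 : finsler M2)
    (f1 : warping M1) (f2 : warping M2) :
  C_reducible (doubly_warped F1 F2 f1 f2) ->
  riemannian (doubly_warped F1 F2 f1 f2).
Proof.
move=> cred i1 p1 i2 p2 A d1 d2.
(* Convexity is given for the metric itself; scaling it by k multiplies the fundamental tensor by
   k^2 > 0. *)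
have pd (m : nat) (M : manifold R m) (F : finsler M) i p (k : R) :
    dom i p -> 0 < k -> forall z, z != 0 ->
    posdef (fundamental (fun z => k * F (tangent_at i p z)) z).
  move=> ip k0 z z0 x x0.
  rewrite (fundamental_scaled _ (smooth_on_fibre F ip)) //.
  rewrite -scalemxAr -scalemxAl mxE mulr_gt0 ?exprn_gt0 //.
  exact: (metric_convex F ip z0).
(* On one fibre the warping functions are constants, and each scales the metric of the other
   factor. *)
apply: (@C_reducible_quadratic R n1 n2
  (fun z => f2 p2 * F1 (tangent_at i1 p1 z))
  (fun z => f1 p1 * F2 (tangent_at i2 p2 z))).
- move=> y; rewrite /fibre_metric /doubly_warped /= sqr_sqrtr ?exprMn //.
  by rewrite addr_ge0 // mulr_ge0 // sqr_ge0.
- exact/smooth_on_scaled_sqr/smooth_on_fibre.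
- exact/smooth_on_scaled_sqr/smooth_on_fibre.
- by apply: scaled_sqr_homogeneous; exact: fibre_homogeneous.
- by apply: scaled_sqr_homogeneous; exact: fibre_homogeneous.
- exact/pd/warp_gt0.
- exact/pd/warp_gt0.
- by move=> z sz; exact: cred.
Qed.
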